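(* Let $(X,\sigma)$ be a symbolic minimal set. Then $(X,\sigma)$ is topologically conjugate to the Morse minimal set $(M,\sigma)$ if and only if there exist $k\ge 0$ and $2^k$-blocks $C_0,C_1,C_0',C_1'$ with $C_0\neq C_1$ such that some point in $X$ can be written as a concatenation of $C_0,C_1,C_0'$, and $C_1'$ satisfying the following two conditions. (i) Every second block in the concatenation forms a sequence of $C_0$ and $C_1$ that, thought of as a bilaterally infinite sequence with letters $C_0$ and $C_1$, contains no block of the form $BBb$, where $B$ is a nonempty block and $b$ is the first letter of $B$. (ii) The gaps (the remaining places in the concatenation) are filled in according to the following nearest neighbor rule: $C_0$ goes between $C_1$ and $C_1$; $C_1$ goes between $C_0$ and $C_0$; $C_0'$ goes between $C_1$ (on the left) and $C_0$ (on the right); $C_1'$ goes between $C_0$ (on the left) and $C_1$ (on the right). Moreover, for given such $k$, $C_0,C_1,C_0',C_1'$, if some point in $X$ can be so written, then every point in $X$ can be so written.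
   Context: $\sigma$ denotes the left shift on bilaterally infinite sequences, $[\sigma(x)]_i=x_{i+1}$. A symbolic minimal set $(X,\sigma)$ is a nonempty closed subset $X$ of $A^{\mathbb Z}$ (product topology), $A$ a finite alphabet, with $\sigma(X)=X$ and with every shift orbit dense in $X$. Two systems $(X,S)$ and $(Y,R)$ are topologically conjugate if there is a homeomorphism $h:X\to Y$ with $h\circ S=R\circ h$. A block is a finite word, and an $n$-block is a word of length $n$; here $C_0,C_1,C_0',C_1'$ are words over the alphabet of $X$. The only inequality required among them is $C_0\ne C_1$; other coincidences (e.g. $C_0=C_0'$) are allowed. That a point $x=(x_i)_{i\in\mathbb Z}$ is written as a concatenation of $C_0,C_1,C_0',C_1'$ satisfying (i) and (ii) means: there are an offset $j\in\mathbb Z$ and a sequence $s=(s_n)\in\{0,1\}^{\mathbb Z}$ such that, with $D_n:=x_{j+2^kn}\,x_{j+2^kn+1}\dots x_{j+2^kn+2^k-1}$ for $n\in\mathbb Z$, one has $D_{2n}=C_{s_n}$ for all $n$; the sequence $s$ contains no block of the form $BBb$ with $B$ a nonempty block over $\{0,1\}$ and $b$ the first letter of $B$; and, for all $n$, $D_{2n+1}=C_0$ if $(s_n,s_{n+1})=(1,1)$, $D_{2n+1}=C_1$ if $(s_n,s_{n+1})=(0,0)$, $D_{2n+1}=C_0'$ if $(s_n,s_{n+1})=(1,0)$, and $D_{2n+1}=C_1'$ if $(s_n,s_{n+1})=(0,1)$. The Morse substitution is $\mu(0)=01$, $\mu(1)=10$. It determines a map $\overline\mu:\{0,1\}^{\mathbb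 Z}\to\{0,1\}^{\mathbb Z}$ by $[\overline\mu(x)]_{2n}[\overline\mu(x)]_{2n+1}=\mu(x_n)$ for all $n\in\mathbb Z$. The two-sided Morse sequence $m=\dots10010110.01101001\dots$ is the unique point $x$ fixed by $\overline\mu^{\,2}$ with $x_{-1}=0$ and $x_0=0$ (the decimal point separates negative from non-negative indices). The Morse minimal set is $M=\mathrm{cl}\{\sigma^n(m):n\in\mathbb Z\}$. *)

(* Defs.v *)
From HB Require Import structures.
From mathcomp Require Import all_boot all_order all_algebra.
From mathcomp Require Import all_classical topology.
From mathcomp Require Import zify.

Set Implicit Arguments.
Unset Strict Implicit.
Unset Printing Implicit Defensive.

Import GRing.Theory.

Local Open Scope classical_set_scope.
Local Open Scope ring_scope.

Definition fullshift (A : finType) : topologicalType :=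
  {ptws int -> discrete_topology A}.

Definition shiftz (A : finType) (n : int) (x : fullshift A) : fullshift A :=
  fun i : int => x (i + n).

Definition shift (A : finType) : fullshift A -> fullshift A := @shiftz A 1.

Definition orbit (A : finType) (x : fullshift A) : set (fullshift A) :=
  range (fun n : int => shiftz n x).

Definition symbolic_minimal (A : finType) (X : set (fullshift A)) : Prop :=
  [/\ X !=set0,
      closed X,
      @shift A @` X = X
    & forall x, X x -> X `<=` closure (orbit x)].

(* Subsystems are given as subsets of ambient spaces; only the restrictions of
   [h] to [X] and of its inverse [g] to [Y] matter. *)
Definition topologically_conjugate (T U : topologicalType)
    (X : set T) (S : T -> T) (Y : set U) (R : U -> U) : Prop :=
  exists (h : T -> U) (g : U -> T),
    [/\ set_bij X Y h,
        {in X, cancel h g},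
        {within X, continuous h},
        {within Y, continuous g}
      & {in X, forall x, h (S x) = R (h x)}].

(* The letters 0 and 1 are [false] and [true]. *)
Definition mu (b : bool) : seq bool := if b then [:: true; false]
                                       else [:: false; true].

(* [mubar x]_{2n} [mubar x]_{2n+1} = mu x_n; [%/] and [%%] are the Euclidean
   quotient and remainder, so this is also right at negative places. *)
Definition mubar (x : fullshift bool) : fullshift bool :=
  fun i : int => nth false (mu (x (i %/ 2)%Z)) `|(i %% 2)%Z|%N.

Definition is_morse_sequence (x : fullshift bool) : Prop :=
  [/\ mubar (mubar x) = x, x (-1) = false & x 0 = false].

(* The point with this property, which exists and is unique by
   [morse_sequenceP] and [morse_sequence_unique] below. *)
Definition morse_sequence : fullshift bool :=
  xget (fun=> false) [set x | is_morse_sequence x].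

Definition morse_minimal_set : set (fullshift bool) :=
  closure (orbit morse_sequence).

Definition word (A : finType) (x : fullshift A) (i : int) (n : nat) : seq A :=
  mkseq (fun t : nat => x (i + t%:Z)) n.

Definition occurs (A : finType) (w : seq A) (x : fullshift A) : Prop :=
  exists i : int, word x i (size w) = w.

(* The nonempty block B is written b :: B'. *)
Definition no_BBb (s : fullshift bool) : Prop :=
  forall (b : bool) (B' : seq bool),
    ~ occurs ((b :: B') ++ (b :: B') ++ [:: b]) s.

Definition gap_block (T : Type) (C0 C1 C0' C1' : T) (l r : bool) : T :=
  match l, r with
  | true, true => C0
  | false, false => C1
  | true, false => C0'
  | false, true => C1'
  end.

Definition morse_concatenation (A : finType) (k : nat)
    (C0 C1 C0' C1' : (2 ^ k)%N.-tuple A) (x : fullshift A) : Prop :=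
  exists (j : int) (s : fullshift bool),
    let D (n : int) : seq A := word x (j + (2 ^ k)%N%:Z * n) (2 ^ k)%N in
    [/\ forall n : int, D (2 * n) = (if s n then C1 else C0) :> seq A,
        no_BBb s
      & forall n : int,
          D (2 * n + 1) = gap_block C0 C1 C0' C1' (s n) (s (n + 1)) :> seq A].

Lemma mubarE (x : fullshift bool) (i : int) :
  mubar x i = x (i %/ 2)%Z (+) ((i %% 2)%Z == 1).
Proof.
have [E | E] : (i %% 2)%Z = 0 \/ (i %% 2)%Z = 1 by lia.
  by rewrite /mubar /mu E; case: (x _).
by rewrite /mubar /mu E; case: (x _).
Qed.

Definition morse_bits (i : int) : bool :=
  (((i %/ 2)%Z %% 2)%Z == 1) (+) ((i %% 2)%Z == 1).

Lemma mubar2E (x : fullshift bool) (i : int) :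
  mubar (mubar x) i = x (i %/ 4)%Z (+) morse_bits i.
Proof.
by rewrite !mubarE (_ : ((i %/ 2)%Z %/ 2)%Z = (i %/ 4)%Z) ?addbA //; lia.
Qed.

Lemma morse_sequence_unique (x y : fullshift bool) :
  is_morse_sequence x -> is_morse_sequence y -> x = y.
Proof.
move=> [xE x1 x0] [yE y1 y0]; apply/funext => i.
have [n] := ubnP `|i|%N; elim: n i => // n IHn i lt_in.
have [-> | ] := eqVneq i 0; first by rewrite x0 y0.
have [-> | i1 i0] := eqVneq i (-1); first by rewrite x1 y1.
by rewrite -xE -yE !mubar2E IHn //; lia.
Qed.

Fixpoint morse_approx (n : nat) (i : int) : bool :=
  if n is n'.+1 then morse_approx n' (i %/ 4)%Z (+) morse_bits i else false.

Lemma morse_sequence_exists : exists x, is_morse_sequence x.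
Proof.
have approx0 n : morse_approx n 0 = false by elim: n => //= n ->.
have approx1 n : morse_approx n (-1) = false by elim: n => //= n ->.
have stable n p i : (`|i| <= n)%N -> (`|i| <= p)%N ->
    morse_approx n i = morse_approx p i.
  elim: n p i => [|n IHn] p i le_in le_ip.
    by rewrite (_ : i = 0) ?approx0 //; lia.
  have [-> | i0] := eqVneq i 0; first by rewrite !approx0.
  have [-> | i1] := eqVneq i (-1); first by rewrite !approx1.
  case: p le_ip => [|p] le_ip; first lia.
  by congr (_ (+) _); apply: IHn; lia.
exists (fun i => morse_approx `|i|%N i); split; rewrite ?approx1 //.
apply/funext => i; rewrite mubar2E.
rewrite -[RHS](stable `|i|.+1 `|i|%N) //=.
by rewrite (stable `|i|%N `|(i %/ 4)%Z|%N) //; lia.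
Qed.

Lemma morse_sequenceP : is_morse_sequence morse_sequence.
Proof. by have [x xP] := morse_sequence_exists; exact: (xgetI _ xP). Qed.

(* Main.v *)
Require Import Defs.
From mathcomp Require Import all_boot all_order all_algebra.
From mathcomp Require Import all_classical topology.
From mathcomp Require Import zify.

(** Call a bi-infinite 0-1 sequence overlap-free when it contains no BBb, and
    let [concatenation s] be the point obtained from a sequence [s] by the
    nearest neighbor rule, so that the points to be characterized are the
    shifts of [concatenation s] for overlap-free [s].

    Overlap-free sequences. Every overlap-free sequence is a shift of [mubar z]
    with [z] overlap-free ([desubstitution]), and conversely [mubar] creates no
    overlap ([overlap_mubar]). Iterating, each overlap-free sequence is, up to a
    shift, [iter k mubar z]; since all four words of length two occur in [z],
    any finite word of one overlap-free sequence occurs in any other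
    ([window_recurs]). So the overlap-free sequences form a minimal set, which
    is the Morse minimal set ([no_BBb_minimal], [morse_minimal_setE]).

    Recognizability. A concatenation determines its phase modulo 2^(k+1), hence
    the sequence it comes from. If two phases d apart were possible, then
    minimality would make d a period of the whole system
    [concatenation @` no_BBb], and therefore also 2^k, the 2-part of d being at
    most 2^k. Then both the even blocks and the gaps would be read from
    overlap-free sequences, and the image of the Morse sequence under the gap
    rule would contain 000 or 111, or the Morse sequence would violate a
    constraint among its first letters ([concatenation_phase]).

    Sufficiency. By recognizability and compactness, any two systems of
    concatenations with blocks of the same length 2^k, each with distinct blocks
    C0 and C1, are conjugate: a point is decoded and encoded again with the other
    blocks
    ([concatenations_conjugate]). The Morse minimal set is itself such a system,
    for the blocks mu^k(0), mu^k(1), mu^k(0), mu^k(1)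
    ([morse_minimal_set_concatenation]). A minimal set containing one
    concatenation is the whole system ([minimal_set_concatenations]).

    Necessity. Let [g] be the inverse of a conjugacy. It is a local rule, so for
    large k the blocks of length 2^k of [g (iter k mubar m)], displaced by the
    radius of the rule, depend on two consecutive letters of the Morse sequence
    [m] only. Writing [m = mubar z], the letters of [m] at 2n and 2n+1 are
    [z n] and its opposite; the nearest neighbor rule for [z] is exactly this
    dependence on pairs of letters ([conjugate_concatenation]). *)

Set Implicit Arguments.
Unset Strict Implicit.
Unset Printing Implicit Defensive.

Import GRing.Theory Num.Theory.

Local Open Scope classical_set_scope.
Local Open Scope ring_scope.

(** * Overlaps and the Morse substitution *)

(** An occurrence at [i] of a word BBb with B of length [p], phrased as a
    local period: this form is stable under shifts and substitutions. *)
Definition overlap (x : int -> bool) (i : int) (p : nat) : Prop :=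
  forall j : int, i <= j <= i + p%:Z -> x j = x (j + p%:Z).

Lemma no_BBbP (x : fullshift bool) :
  no_BBb x <-> forall i p, (0 < p)%N -> ~ overlap x i p.
Proof.
split=> [xO i [//|p] _ ov | xO b B [i]].
  apply: (xO (x i) (word x (i + 1) p)); exists i.
  apply: (@eq_from_nth _ false) => [|t]; rewrite size_mkseq //.
  move=> lt_t; rewrite nth_mkseq //.
  rewrite !size_cat /= !size_mkseq in lt_t.
  pose B := x i :: word x (i + 1) p.
  have nthB u : (u < p.+1)%N -> nth false B u = x (i + u%:Z).
    case: u => [|u] lt_u; first by rewrite addr0.
    by rewrite /B /= nth_mkseq //; congr x; lia.
  rewrite -/B; have szB : size B = p.+1 by rewrite /= size_mkseq.
  rewrite !nth_cat szB; case: ifP => [/nthB -> // | t_p].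
  case: ifP => [/nthB -> | t_2p].
    by rewrite [RHS]ov; [congr x; lia | lia].
  rewrite (_ : (t - p.+1 - p.+1)%N = 0%N) /=; last lia.
  rewrite [RHS]ov; last by lia.
  rewrite [RHS]ov; last by lia.
  by congr x; lia.
set W := _ ++ _; pose p := (size B).+1; rewrite /word => eqW.
have nthW (t : nat) : (t <= 2 * p)%N -> x (i + t%:Z) = nth false W t.
  move=> le_t; rewrite -eqW nth_mkseq //.
  by rewrite !size_cat /= /p in le_t *; lia.
apply: (xO i p) => // j le_j.
have [t jE le_t] : exists2 t : nat, j = i + t%:Z & (t <= p)%N.
  by exists `|(j - i)%R|%N; lia.
rewrite jE -addrA -PoszD !nthW; [|lia|lia].
rewrite /W !nth_cat -[size (b :: B)]/p.
have [t_p|p_t] := ltnP t p.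
  by rewrite ifF ?addnK ?t_p //; lia.
have -> : t = p by lia.
by rewrite subnn (_ : (p + p < p)%N = false) ?addnK ?ltnn ?subnn //; lia.
Qed.

Lemma overlap_shiftz (x : fullshift bool) n i p :
  overlap (shiftz n x) i p -> overlap x (i + n) p.
Proof.
move=> ov j le_j; have := ov (j - n).
rewrite /shiftz subrK => ->; last lia.
by congr x; lia.
Qed.

Lemma no_BBb_shiftz (n : int) (x : fullshift bool) : no_BBb x -> no_BBb (shiftz n x).
Proof.
by move=> /no_BBbP xO; apply/no_BBbP => i p p0 /overlap_shiftz; apply: xO.
Qed.

Lemma shiftzD (A : finType) (a b : int) (x : fullshift A) :
  shiftz a (shiftz b x) = shiftz (a + b) x.
Proof. by apply/funext => i; rewrite /shiftz addrA. Qed.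

Lemma shiftz0 (A : finType) (x : fullshift A) : shiftz 0 x = x.
Proof. by apply/funext => i; rewrite /shiftz addr0. Qed.

Lemma even_or_odd (i : int) : exists n, i = 2 * n \/ i = 2 * n + 1.
Proof. by exists (i %/ 2)%Z; lia. Qed.

Lemma mubar_even (x : fullshift bool) (n : int) : mubar x (2 * n) = x n.
Proof. by rewrite mubarE (_ : _ == 1 = false) ?addbF; [congr x|]; lia. Qed.

Lemma mubar_odd (x : fullshift bool) (n : int) : mubar x (2 * n + 1) = ~~ x n.
Proof. by rewrite mubarE (_ : _ == 1 = true) ?addbT; [congr (~~ x _)|]; lia. Qed.

Lemma mubar_shiftz (n : int) (x : fullshift bool) :
  mubar (shiftz n x) = shiftz (2 * n) (mubar x).
Proof.
apply/funext => i; rewrite mubarE /shiftz mubarE.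
by congr (_ (+) _); [congr x | congr (_ == _)]; lia.
Qed.

(** If [p] is odd, a pair of positions 2n, 2n+1, where [mubar x] alternates,
    is moved by [p] onto a pair 2n+1, 2n+2; so the word alternates throughout,
    against the odd period. If [p] is even, the overlap descends to [x]. *)
Lemma overlap_mubar (x : fullshift bool) i p : (0 < p)%N ->
  overlap (mubar x) i p -> exists q, p = (2 * q)%N /\ overlap x (i %/ 2)%Z q.
Proof.
move=> p0 ov.
have [q [pE|pE]] : exists q, (p = 2 * q \/ p = (2 * q).+1)%N.
  by exists p./2; lia.
  exists q; split=> // n le_n.
  have [ev|od] : (i <= 2 * n <= i + p%:Z) \/ (i <= 2 * n + 1 <= i + p%:Z) by lia.
    have := ov _ ev; rewrite mubar_even => ->.
    by rewrite -[RHS]mubar_even; congr (mubar x _); lia.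
  have := ov _ od; rewrite mubar_odd (_ : _ + _ + _ = 2 * (n + q%:Z) + 1); last lia.
  by rewrite mubar_odd => /negb_inj.
(* Odd period: the word alternates. *)
have alt j : i <= j < i + p%:Z -> mubar x (j + 1) = ~~ mubar x j.
  move=> le_j.
  have [n [jE|jE]] := even_or_odd j.
  - by rewrite jE mubar_odd mubar_even.
  rewrite (ov j); last lia.
  rewrite (ov (j + 1)); last lia.
  rewrite (_ : j + 1 + p%:Z = 2 * (n + q%:Z + 1) + 1); last lia.
  rewrite (_ : j + p%:Z = 2 * (n + q%:Z + 1)); last lia.
  by rewrite mubar_odd mubar_even.
have alts (t : nat) : (t <= p)%N -> mubar x (i + t%:Z) = odd t (+) mubar x i.
  elim: t => [|t IHt] le_t; first by rewrite addr0.
  rewrite (_ : i + t.+1%:Z = i + t%:Z + 1); last lia.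
  by rewrite alt ?IHt /= ?addNb; lia.
have := alts p (leqnn p); rewrite -ov ?pE /= ?oddM /=; last lia.
by case: (mubar x i).
Qed.

Lemma mubar_no_BBb (x : fullshift bool) : no_BBb x -> no_BBb (mubar x).
Proof.
move=> /no_BBbP xO; apply/no_BBbP => i p p0 /(overlap_mubar p0) [q [pE]].
by apply: xO; lia.
Qed.

Lemma no_BBb_mubar (x : fullshift bool) : no_BBb (mubar x) -> no_BBb x.
Proof.
move=> /no_BBbP xO; apply/no_BBbP => i p p0 ov.
apply: (xO (2 * i) (2 * p)%N) => [|j le_j]; first lia.
rewrite !mubarE (_ : ((j + _) %/ 2)%Z = (j %/ 2)%Z + p%:Z); last lia.
by rewrite -ov; [congr (_ (+) _); congr (_ == _); lia | lia].
Qed.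

(** Infinite descent on the period: [m] and [mubar m] are images of each other
    under [mubar]. *)
Lemma morse_no_BBb : no_BBb morse_sequence.
Proof.
have [mE _ _] := morse_sequenceP; set m := morse_sequence in mE *.
suff noO p i : (0 < p)%N -> ~ overlap m i p /\ ~ overlap (mubar m) i p.
  by apply/no_BBbP => i p /(noO p i) [].
elim/ltn_ind: p i => p IHp i p0.
split=> ov.
  rewrite -mE in ov; have [q [pE qov]] := overlap_mubar p0 ov.
  by have [||_] := IHp q _ (i %/ 2)%Z; [lia | lia | apply].
have [q [pE qov]] := overlap_mubar p0 ov.
by have [||+ _] := IHp q _ (i %/ 2)%Z; [lia | lia | apply].
Qed.

Lemma morse_at (i : int) :
  morse_sequence i = morse_sequence (i %/ 4)%Z (+) morse_bits i.
Proof. by have [mE _ _] := morse_sequenceP; rewrite -[in LHS]mE mubar2E. Qed.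

Lemma morse_prefix : [/\ morse_sequence 0 = false, morse_sequence 1 = true,
  morse_sequence 2 = true, morse_sequence 3 = false &
  [/\ morse_sequence 4 = true, morse_sequence 5 = false,
  morse_sequence 6 = false & morse_sequence 7 = true]].
Proof.
have [_ _ m0] := morse_sequenceP.
have m1 : morse_sequence 1 = true by rewrite morse_at [morse_sequence _]m0.
have m2 : morse_sequence 2 = true by rewrite morse_at [morse_sequence _]m0.
have m3 : morse_sequence 3 = false by rewrite morse_at [morse_sequence _]m0.
have m4 : morse_sequence 4 = true by rewrite morse_at [morse_sequence _]m1.
have m5 : morse_sequence 5 = false by rewrite morse_at [morse_sequence _]m1.
have m6 : morse_sequence 6 = false by rewrite morse_at [morse_sequence _]m1.
have m7 : morse_sequence 7 = true by rewrite morse_at [morse_sequence _]m1.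
by split.
Qed.

Section OverlapFree.
Variables (x : fullshift bool) (xO : no_BBb x).

Section Window.
Variable i : int.
Let y (t : nat) : bool := x (i + t%:Z).

(** The letters from [i] on, indexed by natural numbers so that small windows
    can be treated by enumeration. *)
Lemma window_overlapF t p : (0 < p)%N ->
  ~ forall u, (u <= p)%N -> y (t + u) = y (t + u + p).
Proof.
move=> p0 ov; move/no_BBbP: xO => /(_ (i + t%:Z) p p0); apply=> j le_j.
have := ov `|(j - i - t%:Z)%R|%N; rewrite /y.
rewrite (_ : i + _ = j); last lia.
by rewrite (_ : i + _ = j + p%:Z); [apply; lia | lia].
Qed.

Lemma no_cube t : ~~ ((y t == y t.+1) && (y t.+1 == y t.+2)).
Proof.
apply/negP => /andP[/eqP e0 /eqP e1]; apply: (@window_overlapF t 1%N) => //.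
by case=> [|[|u]] // _; rewrite ?addn0 ?addn1 ?e0.
Qed.

Lemma no_ababa t :
  ~~ [&& y t == y t.+2, y t.+1 == y t.+3 & y t.+2 == y t.+4].
Proof.
apply/negP => /and3P[/eqP e0 /eqP e1 /eqP e2].
apply: (@window_overlapF t 2%N) => //.
by case=> [|[|[|u]]] // _; rewrite ?addn0 ?addn1 ?addn2.
Qed.

Lemma no_baabaab t :
  ~~ [&& y t == y t.+3, y t.+1 == y t.+4, y t.+2 == y t.+4.+1
       & y t.+3 == y t.+4.+2].
Proof.
apply/negP => /and4P[/eqP e0 /eqP e1 /eqP e2 /eqP e3].
apply: (@window_overlapF t 3%N) => //.
by case=> [|[|[|[|u]]]] // _; rewrite ?addn0 ?addn1 ?addn2 ?addn3.
Qed.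

(** Among five consecutive letters there are two changes of letter, and two
    consecutive changes are of opposite kinds. *)
Lemma both_changes a : exists j, x j = a /\ x (j + 1) = ~~ a.
Proof.
have [[c0 c1] c2] := (no_cube 0%N, no_cube 1%N, no_cube 2%N).
suff [t [ta tb]] : exists t, y t = a /\ y t.+1 = ~~ a.
  by exists (i + t%:Z); rewrite -tb /y -ta; split=> //; congr x; lia.
suff /or4P : [|| (y 0%N == a) && (y 1%N == ~~ a), (y 1%N == a) && (y 2%N == ~~ a),
    (y 2%N == a) && (y 3%N == ~~ a) | (y 3%N == a) && (y 4%N == ~~ a)].
  by case=> /andP[/eqP ? /eqP ?]; eexists; split; eassumption.
move: c0 c1 c2.
by move: a (y 0%N) (y 1%N) (y 2%N) (y 3%N) (y 4%N) => [] [] [] [] [] [].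
Qed.

End Window.

Let double (i : int) := x i == x (i + 1).

Let doubleE i (t : nat) :
  (x (i + t%:Z) == x (i + t.+1%:Z)) = double (i + t%:Z).
Proof. by rewrite /double; congr (_ == _); congr x; lia. Qed.

Lemma double_exists : exists i, double i.
Proof.
suff /or4P : [|| double (0 + 0%N%:Z), double (0 + 1%N%:Z), double (0 + 2%N%:Z)
    | double (0 + 3%N%:Z)] by case=> d; eexists; exact: d.
have := no_ababa 0 0%N; rewrite -!doubleE.
move: (x _) (x _) (x _) (x _) (x _) => [] [] [] [] [] //.
Qed.

(** After a double letter aa, the next double letter comes two or four places
    later: one place later gives aaa, three places later gives baabaab, and a
    longer alternation contains ababa. *)
Lemma double_next i : double i ->
  [/\ ~~ double (i + 1), ~~ double (i + 3) & double (i + 2) || double (i + 4)].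
Proof.
set j := i - 1.
have -> : double (i + 1) = double (j + 2%N%:Z) by congr double; lia.
have -> : double (i + 2) = double (j + 3%N%:Z) by congr double; lia.
have -> : double (i + 3) = double (j + 4%N%:Z) by congr double; lia.
have -> : double (i + 4) = double (j + 5%N%:Z) by congr double; lia.
have -> : double i = double (j + 1%N%:Z) by congr double; lia.
rewrite -!doubleE; suff: forall y : nat -> bool, y = (fun t => x (j + t%:Z)) ->
  y 1%N == y 2%N -> [&& y 2%N != y 3%N, y 4%N != y 5%N
    & (y 3%N == y 4%N) || (y 5%N == y 6%N)].
  by move=> /(_ _ erefl) /[apply] /and3P[].
move=> y yE.
have [[c0 c1] c2] := (no_cube j 0%N, no_cube j 1%N, no_cube j 2%N).
(* Seven letters starting one place before the double letter: all 128 cases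
   are enumerated. *)
have [[c3 c4] a0] := (no_cube j 3%N, no_cube j 4%N, no_ababa j 0%N).
have [[a1 a2] b0] := (no_ababa j 1%N, no_ababa j 2%N, no_baabaab j 0%N).
have E t : x (j + t%:Z) = y t by rewrite yE.
rewrite !{}E in c0 c1 c2 c3 c4 a0 a1 a2 b0 *.
move: c0 c1 c2 c3 c4 a0 a1 a2 b0.
by move: (y 0%N) (y 1%N) (y 2%N) (y 3%N) (y 4%N) (y 5%N) (y 6%N) =>
  [] [] [] [] [] [] [].
Qed.

Lemma double_odd i (n : nat) : double i -> ~~ double (i + (2 * n + 1)%:Z).
Proof.
elim/ltn_ind: n i => n IHn i /double_next[d1 d3 d24].
case: n IHn => [|[|n]] IHn //.
case/orP: d24 => dj.
  rewrite (_ : _ + _ = i + 2 + (2 * n.+1 + 1)%N%:Z); last lia.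
  exact: IHn.
rewrite (_ : _ + _ = i + 4 + (2 * n + 1)%N%:Z); last lia.
by apply: IHn; [lia | exact: dj].
Qed.

(** All double letters start at positions of one parity. *)
Lemma double_parity i (n : int) : double i -> ~~ double (i + (2 * n + 1)).
Proof.
move=> di; have [n0|n0] := boolP (0 <= n).
  have := @double_odd i `|n|%N di.
  by rewrite (_ : _ + _ = i + (2 * n + 1)); last lia.
apply/negP => /(@double_odd _ `|(n + 1)%R|%N).
by rewrite (_ : _ + _ = i) ?di //; lia.
Qed.

(** Cutting the sequence so that no double letter lies inside a pair leaves
    only the pairs 01 and 10. *)
Lemma desubstitution : exists (n : int) (z : fullshift bool),
  no_BBb z /\ x = shiftz n (mubar z).
Proof.
have [i di] := double_exists.
pose z : fullshift bool := fun n => x (i + (2 * n + 1)).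
have xE : x = shiftz (- i - 1) (mubar z).
  apply/funext => j; rewrite /shiftz.
  have [n [->|->]] : exists n, j = i + (2 * n + 1) \/ j = i + (2 * n + 1) + 1.
  - by exists ((j - i - 1) %/ 2)%Z; lia.
  - by rewrite (_ : _ + (- i - 1) = 2 * n) ?mubar_even //; lia.
  rewrite (_ : _ + (- i - 1) = 2 * n + 1); last lia.
  have := double_parity n di; rewrite mubar_odd /double /z.
  by case: (x _) (x _) => [] [].
exists (- i - 1), z; split=> //; apply: no_BBb_mubar.
have -> : mubar z = shiftz (i + 1) x.
  by rewrite xE shiftzD (_ : _ + _ = 0) ?shiftz0 //; lia.
exact: no_BBb_shiftz.
Qed.

End OverlapFree.

(** * Iterated desubstitution and recurrence of words *)

Lemma iter_mubar_shiftz k (n : int) (x : fullshift bool) :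
  iter k mubar (shiftz n x) = shiftz ((2 ^ k)%N%:Z * n) (iter k mubar x).
Proof.
elim: k => [|k IHk] /=; first by rewrite mul1r.
by rewrite IHk mubar_shiftz expnS PoszM mulrA.
Qed.

(** The second summand is a pattern which depends on the position only. *)
Lemma iter_mubarE k (x : fullshift bool) (i : int) :
  iter k mubar x i
    = x (i %/ (2 ^ k)%N%:Z)%Z (+) iter k mubar (fun=> false) i.
Proof.
elim: k i => [|k IHk] i /=; first by rewrite divz1 addbF.
rewrite !mubarE IHk -addbA; congr (_ (+) _); congr x.
by rewrite expnS PoszM divzMA_ge0.
Qed.

Lemma iter_mubar_block k (x : fullshift bool) (p t : int) :
  0 <= t < (2 ^ k)%N%:Z ->
  iter k mubar x ((2 ^ k)%N%:Z * p + t) = x p (+) iter k mubar (fun=> false) t.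
Proof.
move=> le_t; have N0 : (2 ^ k)%N%:Z != 0 by have := expn_gt0 2 k; lia.
rewrite iter_mubarE mulrC divzMDl // divz_small ?addr0; last lia.
rewrite addrC mulrC.
rewrite -[in LHS]/(shiftz ((2 ^ k)%N%:Z * p) (iter k mubar (fun=> false)) t).
by rewrite -iter_mubar_shiftz.
Qed.

(** Twice the block length is enough room for any window of at most a block
    length, wherever it starts. *)
Lemma iter_mubar_window k (x y : fullshift bool) (p q t : int) :
  0 <= t < 2 * (2 ^ k)%N%:Z -> x p = y q -> x (p + 1) = y (q + 1) ->
  iter k mubar x ((2 ^ k)%N%:Z * p + t) = iter k mubar y ((2 ^ k)%N%:Z * q + t).
Proof.
move=> le_t xy xy1; have [lt_t|le_Nt] := boolP (t < (2 ^ k)%N%:Z).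
  by rewrite !iter_mubar_block ?xy //; lia.
have shift_block r : (2 ^ k)%N%:Z * r + t
    = (2 ^ k)%N%:Z * (r + 1) + (t - (2 ^ k)%N%:Z) by lia.
by rewrite !shift_block !iter_mubar_block ?xy1 //; lia.
Qed.

Lemma iter_mubar_no_BBb k (x : fullshift bool) :
  no_BBb x -> no_BBb (iter k mubar x).
Proof. by move=> xO; elim: k => //= k; exact: mubar_no_BBb. Qed.

Lemma desubstitution_iter k (x : fullshift bool) : no_BBb x ->
  exists (n : int) (z : fullshift bool), no_BBb z /\ x = shiftz n (iter k mubar z).
Proof.
elim: k x => [|k IHk] x xO; first by exists 0, x; rewrite shiftz0.
have [n [z [zO ->]]] := IHk x xO.
have [p [w [wO ->]]] := desubstitution zO.
exists (n + (2 ^ k)%N%:Z * p), w; split=> //.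
by rewrite iter_mubar_shiftz shiftzD -iterSr.
Qed.

(** A change 10 in the desubstituted sequence becomes 1001, which contains 00,
    and 01 becomes 0110, which contains 11. *)
Lemma all_pairs (x : fullshift bool) (a b : bool) : no_BBb x ->
  exists i, x i = a /\ x (i + 1) = b.
Proof.
have change z c : no_BBb z -> exists i, z i = c /\ z (i + 1) = ~~ c.
  by move=> zO; exact: (both_changes zO 0 c).
move=> xO; have [->|ab] := eqVneq b (~~ a); first exact: change.
have -> : b = a by case: a b ab => [] [].
have [n [z [/change zP ->]]] := desubstitution xO.
have [i [z0 z1]] := zP (~~ a).
exists (2 * i + 1 - n); rewrite /shiftz subrK mubar_odd z0 negbK; split=> //.
rewrite (_ : _ + n = 2 * (i + 1)); last lia.
by rewrite mubar_even z1 negbK.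
Qed.

(** Desubstitute both sequences so often that the window lies in the image of
    two letters, then find these two letters in the second sequence. *)
Lemma window_recurs (x y : fullshift bool) (n : nat) : no_BBb x -> no_BBb y ->
  exists j : int, forall i : int, - n%:Z <= i <= n%:Z -> x i = y (i + j).
Proof.
move=> xO yO; set k := (2 * n)%N.
have ltN : (2 * n < 2 ^ k)%N by exact: ltn_expl.
have [e [z [zO ->]]] := desubstitution_iter k xO.
have [f [w [wO ->]]] := desubstitution_iter k yO.
set N := (2 ^ k)%N in ltN *; set q := ((e - n%:Z) %/ N%:Z)%Z.
have [p [p0 p1]] := all_pairs (z q) (z (q + 1)) wO.
have [v [eE v0 vN]] : exists v, [/\ e - n%:Z = N%:Z * q + v, 0 <= v & v < N%:Z].
  have N0 : 0 < N%:Z by lia.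
  exists ((e - n%:Z) %% N%:Z)%Z.
  by rewrite [_ * q]mulrC -divz_eq modz_ge0 ?lt0r_neq0 // ltz_pmod.
exists (e - f + N%:Z * (p - q)) => i le_i; rewrite /shiftz.
rewrite (_ : i + e = N%:Z * q + (v + n%:Z + i)); last lia.
rewrite (_ : _ + f = N%:Z * p + (v + n%:Z + i)); last lia.
by apply: iter_mubar_window; rewrite ?p0 ?p1 // -/N; lia.
Qed.

(** * Topology of the full shift *)

Definition agree (T : Type) (n : nat) (x y : int -> T) : Prop :=
  forall i : int, - n%:Z <= i <= n%:Z -> x i = y i.

Lemma agreeW (T : Type) (m n : nat) (x y : int -> T) :
  (m <= n)%N -> agree n x y -> agree m x y.
Proof. by move=> le_mn xy i le_i; apply: xy; lia. Qed.

Section FullShift.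
Variable A : finType.
Implicit Types x y : fullshift A.

Lemma nbhs_coord x (i : int) : nbhs x [set y : fullshift A | x i = y i].
Proof.
have : {ptws, nbhs x --> x} by [].
move=> /(@pointwise_cvgP (discrete_topology int) (discrete_topology A)).
move=> /(_ i) /(discrete_cvg _ _).
by apply: filterS => y /= ->.
Qed.

Lemma nbhs_agree x n : nbhs x [set y : fullshift A | agree n x y].
Proof.
have : \forall y \near x, forall k : 'I_(2 * n).+1,
    x (k%:Z - n%:Z) = (y : fullshift A) (k%:Z - n%:Z).
  pose P (k : 'I_(2 * n).+1) (y : fullshift A) := x (k%:Z - n%:Z) = y (k%:Z - n%:Z).
  exact: (@filter_forall _ _ P _ _ (fun k => nbhs_coord x _)).
apply: filterS => y xy i le_i.
have lt_i : (`|(i + n%:Z)%R| < (2 * n).+1)%N by lia.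
by have := xy (Ordinal lt_i) => /=; rewrite (_ : _ - _ = i) //; lia.
Qed.

Lemma nbhs_agreeP x (U : set (fullshift A)) :
  nbhs x U <-> exists n, [set y | agree n x y] `<=` U.
Proof.
split=> [|[n]]; last by move=> /filterS; apply; exact: nbhs_agree.
pose F : set_system (fullshift A) :=
  filter_from [set: nat] (fun n => [set y | agree n x y]).
have FF : Filter F.
  apply: filter_from_filter; first by exists 0%N.
  move=> m n _ _; exists (maxn m n) => // y xy.
  by split; apply: agreeW xy; lia.
have Fx : {ptws, F --> x}.
  apply/(@pointwise_cvgP (discrete_topology int) (discrete_topology A)) => i.
  apply/discrete_cvg; exists `|i|%N => // y /(_ i) xy.
  by rewrite /= -xy //; lia.
by move=> /Fx [n _ xU]; exists n.
Qed.

Lemma fullshift_closureP (S : set (fullshift A)) x :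
  closure S x <-> forall n, exists2 y, S y & agree n x y.
Proof.
split=> [Sx n|Sx U /nbhs_agreeP[n xU]].
  by have [y [Sy xy]] := Sx _ (nbhs_agree x n); exists y.
by have [y Sy /xU Uy] := Sx n; exists y.
Qed.

Lemma fullshift_hausdorff : hausdorff_space (fullshift A).
Proof.
apply: (@hausdorff_product int (fun=> discrete_topology A)) => _.
exact: discrete_hausdorff.
Qed.

Lemma fullshift_compact : compact [set: fullshift A].
Proof.
have := @tychonoff int (fun=> discrete_topology A) (fun=> setT).
rewrite (_ : [set _ | _] = setT); last by apply/seteqP; split.
by apply=> _; apply: finite_compact; exact: finite_finset.
Qed.

Lemma closed_fullshift_compact (S : set (fullshift A)) : closed S -> compact S.
Proof.
by move=> cS; apply: (subclosed_compact cS fullshift_compact).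
Qed.

End FullShift.

Lemma fullshift_continuous (A B : finType) (f : fullshift A -> fullshift B) :
  (forall n, exists m, forall x y, agree m x y -> agree n (f x) (f y)) ->
  continuous f.
Proof.
move=> loc x U /nbhs_agreeP[n xU]; apply/nbhs_agreeP.
by have [m fm] := loc n; exists m => y /fm /xU.
Qed.

Lemma shiftz_continuous (A : finType) n : continuous (@shiftz A n).
Proof.
apply: fullshift_continuous => m; exists (m + `|n|)%N => x y xy i le_i.
by rewrite /shiftz xy //; lia.
Qed.

(** Curtis-Hedlund-Lyndon, for maps that are continuous on a closed set only.
    *)
Lemma uniform_local_rule (A B : finType) (X : set (fullshift A))
    (f : fullshift A -> fullshift B) :
  closed X -> {within X, continuous f} ->
  exists n, forall x y, X x -> X y -> agree n x y -> f x 0 = f y 0.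
Proof.
move=> cX cf; have /compact_near_coveringP covX := closed_fullshift_compact cX.
pose P (n : nat) x := X x -> forall y, X y -> agree n x y -> f x 0 = f y 0.
have : \forall n \near \oo, X `<=` P n.
  apply: covX => x Xx.
  have /subspace_continuousP/(_ x Xx) := cf.
  move=> /(_ _ (nbhs_agree (f x) 0)).
  rewrite /= nbhs_simpl /= /within /= => /nbhs_agreeP[n fx].
  exists ([set y | agree n x y], [set m | (n <= m)%N]) => /=.
    by split; [exact: nbhs_agree | exists n].
  move=> [y m] /= [xy le_nm] Xy z Xz yz.
  have fxy i : agree n x i -> X i -> f i 0 = f x 0.
    by move=> xi Xi; exact/esym/(fx i xi Xi 0).
  rewrite !fxy // => i le_i; rewrite xy //; apply: yz; lia.
move=> [n _ nP]; exists n => x y Xx Xy xy.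
by apply: (nP n) => //=.
Qed.

(** A finite family of maps from a compact set into a Hausdorff space is, onto
    its image, a quotient map: preimages of closed sets are finite unions of
    compact images. *)
Lemma compact_lift_continuous (I : finType) (K T U : topologicalType)
    (C : set K) (p : I -> K -> T) (q : I -> K -> U) (h : T -> U) (X : set T) :
  hausdorff_space T -> compact C ->
  (forall i, continuous (p i)) -> (forall i, continuous (q i)) ->
  X = \bigcup_(i in [set: I]) p i @` C ->
  (forall i z, C z -> h (p i z) = q i z) ->
  {within X, continuous h}.
Proof.
move=> hT cC cp cq XE hq; apply/continuous_closedP => D cD.
apply/closed_subspaceP.
exists (\bigcup_(i in [set: I]) p i @` (C `&` q i @^-1` D)).
  apply: closed_bigcup => [|i _]; first exact: finite_finset.
  apply: compact_closed => //; apply: continuous_compact.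
    exact: continuous_subspaceT.
  by apply: compact_closedI => //; move/continuous_closedP: (cq i); apply.
apply/seteqP; split=> x [].
  move=> [i _ [z [Cz qz] <-]] Xx; split=> //.
  by rewrite /preimage/= /from_subspace hq.
move=> hx Xx; split=> //; move: Xx hx; rewrite XE => -[i _ [z Cz <-]] hz.
exists i => //; exists z => //; split=> //.
by move: hz; rewrite /preimage/= /from_subspace hq.
Qed.

(** * The overlap-free sequences form the Morse minimal set *)

Lemma no_BBb_closed : closed no_BBb.
Proof.
move=> x clx; apply/no_BBbP => i p p0 ov.
have [y /no_BBbP yO xy] := (fullshift_closureP _ _).1 clx (`|i| + 2 * p)%N.
apply: (yO i p p0) => j le_j; rewrite -!xy; first exact: ov.
  by lia.
by lia.
Qed.

Lemma no_BBb_orbit_dense (x y : fullshift bool) :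
  no_BBb x -> no_BBb y -> closure (Defs.orbit y) x.
Proof.
move=> xO yO; apply/fullshift_closureP => n.
have [j xy] := window_recurs n xO yO.
by exists (shiftz j y); [exists j | exact: xy].
Qed.

Lemma orbit_sub (A : finType) (x : fullshift A) (P : set (fullshift A)) :
  (forall n y, P y -> P (shiftz n y)) -> P x -> Defs.orbit x `<=` P.
Proof. by move=> invP Px _ [n _ <-]; exact: invP. Qed.

(** Minimality in the form of an induction principle: a closed invariant
    property of one overlap-free sequence holds for all of them. *)
Lemma no_BBb_minimal (P : set (fullshift bool)) (z : fullshift bool) :
  closed P -> (forall n y, P y -> P (shiftz n y)) -> P z -> no_BBb z ->
  no_BBb `<=` P.
Proof.
move=> cP invP Pz zO x xO; apply: cP.
exact: (closure_subset (orbit_sub invP Pz)) (no_BBb_orbit_dense xO zO).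
Qed.

Lemma morse_minimal_setE : morse_minimal_set = no_BBb.
Proof.
apply/seteqP; split=> x; last by move/no_BBb_orbit_dense; apply; exact: morse_no_BBb.
move=> mx; apply: no_BBb_closed; apply: closure_subset mx.
exact: orbit_sub no_BBb_shiftz morse_no_BBb.
Qed.

(** * Concatenations as a coding of overlap-free sequences *)

(** Modulo 2^(p+1), every nonzero residue has a multiple equal to 2^p. *)
Lemma power2_multiple (p : nat) (e : int) : ~~ ((2 ^ p.+1)%N%:Z %| e)%Z ->
  exists (j : nat) (a : int),
    e * j%:Z + (2 ^ p.+1)%N%:Z * a = (2 ^ p)%N%:Z.
Proof.
elim: p e => [|p IHp] e.
  by move=> e1; exists 1%N, (- (e %/ 2)%Z); lia.
have [f [eE|eE]] := even_or_odd e.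
- rewrite eE expnS PoszM dvdz_mul2l //= => /IHp[j [a fE]].
  by exists j, a; rewrite !expnS in fE *; lia.
by move=> _; exists (2 ^ p.+1)%N, (- f); rewrite eE [(2 ^ p.+2)%N]expnS; lia.
Qed.

Section Concatenation.
Variables (A : finType) (k : nat) (C0 C1 C0' C1' : (2 ^ k)%N.-tuple A).

Let N : nat := (2 ^ k)%N.
Let N0 : 0 < N%:Z. Proof. by rewrite /N; have := expn_gt0 2 k; lia. Qed.

Definition letter_block (c : bool) : (2 ^ k)%N.-tuple A := if c then C1 else C0.

(** The block number [m] of the concatenation along [s]. *)
Definition concat_block (s : fullshift bool) (m : int) : (2 ^ k)%N.-tuple A :=
  if (m %% 2)%Z == 0 then letter_block (s (m %/ 2)%Z)
  else gap_block C0 C1 C0' C1' (s (m %/ 2)%Z) (s ((m %/ 2)%Z + 1)).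

Lemma concat_block_even s n : concat_block s (2 * n) = letter_block (s n).
Proof.
rewrite /concat_block (_ : _ == 0 = true); last lia.
by congr (letter_block (s _)); lia.
Qed.

Lemma concat_block_odd s n :
  concat_block s (2 * n + 1) = gap_block C0 C1 C0' C1' (s n) (s (n + 1)).
Proof.
rewrite /concat_block (_ : _ == 0 = false); last lia.
by rewrite (_ : (_ %/ 2)%Z = n) //; lia.
Qed.

Lemma residue_subproof (i : int) : (`|(i %% (2 ^ k)%N)%Z| < 2 ^ k)%N.
Proof.
have := ltz_pmod i N0; have := modz_ge0 i (lt0r_neq0 N0); rewrite /N; lia.
Qed.

Definition concatenation (s : fullshift bool) : fullshift A := fun i =>
  tnth (concat_block s (i %/ (2 ^ k)%N)%Z) (Ordinal (residue_subproof i)).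

Lemma concatenationE s (m : int) (t : 'I_(2 ^ k)) :
  concatenation s ((2 ^ k)%N%:Z * m + t%:Z) = tnth (concat_block s m) t.
Proof.
have lt_t := ltn_ord t; rewrite -/N in lt_t.
rewrite /concatenation; congr (tnth (concat_block s _) _).
  by rewrite mulrC divzMDl ?divz_small ?addr0 ?lt0r_neq0 //; lia.
apply/val_inj; rewrite /= -/N mulrC modzMDl modz_small //; lia.
Qed.

Lemma int_block (i : int) : exists m (t : 'I_(2 ^ k)), i = (2 ^ k)%N%:Z * m + t%:Z.
Proof.
exists (i %/ N)%Z, (Ordinal (residue_subproof i)) => /=.
by rewrite mulrC gez0_abs -?divz_eq // modz_ge0 ?lt0r_neq0.
Qed.

Lemma eq_concatenation (x : fullshift A) e s :
  x = shiftz e (concatenation s) <->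
  forall m (t : 'I_(2 ^ k)), x ((2 ^ k)%N%:Z * m + t%:Z - e) = tnth (concat_block s m) t.
Proof.
split=> [-> m t|xE]; first by rewrite /shiftz subrK concatenationE.
apply/funext => i; rewrite /shiftz.
have [m [t iE]] := int_block (i + e).
by rewrite iE concatenationE -xE -iE addrK.
Qed.

Lemma word_tupleP (x : fullshift A) i (w : (2 ^ k)%N.-tuple A) :
  word x i (2 ^ k)%N = w :> seq A <-> forall t : 'I_(2 ^ k), x (i + t%:Z) = tnth w t.
Proof.
split=> [xw t|xw]; first by rewrite (tnth_nth (x (i + t%:Z))) -xw nth_mkseq.
apply: (@eq_from_nth _ (x i)); rewrite size_mkseq ?size_tuple // => t lt_t.
by rewrite nth_mkseq // (xw (Ordinal lt_t)) (tnth_nth (x i)).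
Qed.

Lemma morse_concatenationP (x : fullshift A) :
  morse_concatenation C0 C1 C0' C1' x <->
  exists e s, no_BBb s /\ x = shiftz e (concatenation s).
Proof.
split=> [[j [s [ev sO od]]]|[e [s [sO xE]]]].
  exists (- j), s; split=> //; apply/eq_concatenation => m t.
  rewrite opprK addrAC [_ + j]addrC.
  have [n [mE|mE]] := even_or_odd m.
  - rewrite mE concat_block_even.
    have := ev n; rewrite /letter_block; case: (s n) => /word_tupleP; exact.
  rewrite mE concat_block_odd.
  have := od n; case: (s n) (s (n + 1)) => [] [] /word_tupleP; exact.
move/eq_concatenation: xE => xE.
have xw m : word x (- e + (2 ^ k)%N%:Z * m) (2 ^ k)%N = concat_block s m :> seq A.
  by apply/word_tupleP => t; rewrite -xE; congr x; lia.
exists (- e), s; split=> // n.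
  by rewrite xw concat_block_even /letter_block; case: (s n).
by rewrite xw concat_block_odd; case: (s n) (s (n + 1)) => [] [].
Qed.

Lemma concat_block_shiftz a s m :
  concat_block (shiftz a s) m = concat_block s (m + 2 * a).
Proof.
have [q [->|->]] := even_or_odd m.
- by rewrite -mulrDr !concat_block_even.
by rewrite addrAC -mulrDr !concat_block_odd /shiftz addrAC.
Qed.

Lemma concatenation_shiftz a s :
  concatenation (shiftz a s) = shiftz ((2 ^ k.+1)%N%:Z * a) (concatenation s).
Proof.
apply/eq_concatenation => m t.
have -> : (2 ^ k)%N%:Z * m + t%:Z - (2 ^ k.+1)%N%:Z * a
    = (2 ^ k)%N%:Z * (m - 2 * a) + t%:Z by rewrite expnS; lia.
by rewrite concatenationE concat_block_shiftz subrK.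
Qed.

Lemma concatenation_continuous : continuous concatenation.
Proof.
apply: fullshift_continuous => n; exists n.+1 => s s' ss' i le_i.
have [m [t iE]] := int_block i.
have le_m : - n%:Z <= m <= n%:Z.
  by have := ltn_ord t; move: N0 iE le_i; rewrite /N; nia.
rewrite iE !concatenationE; congr (tnth _ t).
have [q [mE|mE]] := even_or_odd m.
- by rewrite mE !concat_block_even ss' //; lia.
by rewrite mE !concat_block_odd !ss' //; lia.
Qed.

Lemma morse_concatenation_shiftz n (x : fullshift A) :
  morse_concatenation C0 C1 C0' C1' x ->
  morse_concatenation C0 C1 C0' C1' (shiftz n x).
Proof.
move=> /morse_concatenationP[e [s [sO ->]]]; apply/morse_concatenationP.
by exists (n + e), s; rewrite shiftzD.
Qed.

(** The phases [0 <= e < 2^(k+1)] suffice, since shifting by 2^(k+1) amounts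
    to shifting the coded sequence. *)
Definition phase_code (e : 'I_(2 ^ k.+1)) (s : fullshift bool) : fullshift A :=
  shiftz e%:Z (concatenation s).

Lemma phase_code_continuous e : continuous (phase_code e).
Proof.
move=> s; apply: (@continuous_comp _ _ _ concatenation (@shiftz A e%:Z)).
  exact: concatenation_continuous.
exact: shiftz_continuous.
Qed.

Lemma morse_concatenationE :
  [set x | morse_concatenation C0 C1 C0' C1' x]
  = \bigcup_(e in [set: 'I_(2 ^ k.+1)]) phase_code e @` no_BBb.
Proof.
apply/seteqP; split=> x.
  move=> /morse_concatenationP[e [s [sO ->]]].
  have L0 : 0 < (2 ^ k.+1)%N%:Z by have := expn_gt0 2 k.+1; lia.
  have := ltz_pmod e L0; have := modz_ge0 e (lt0r_neq0 L0) => r0 rL.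
  have lt_r : (`|(e %% (2 ^ k.+1)%N)%Z| < 2 ^ k.+1)%N by lia.
  exists (Ordinal lt_r) => //.
  exists (shiftz (e %/ (2 ^ k.+1)%N)%Z s); first exact: no_BBb_shiftz.
  rewrite /phase_code concatenation_shiftz shiftzD /= gez0_abs //.
  by rewrite addrC [_%:Z * _]mulrC -divz_eq.
by move=> [e _ [s sO <-]]; apply/morse_concatenationP; exists e%:Z, s.
Qed.

Lemma morse_concatenation_closed :
  closed [set x | morse_concatenation C0 C1 C0' C1' x].
Proof.
rewrite morse_concatenationE; apply: closed_bigcup => [|e _].
  exact: finite_finset.
apply: compact_closed; first exact: fullshift_hausdorff.
apply: continuous_compact; last exact: closed_fullshift_compact no_BBb_closed.
exact/continuous_subspaceT/phase_code_continuous.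
Qed.

Section Recognizability.
Hypothesis C01 : C0 <> C1.

Lemma letter_block_inj : injective letter_block.
Proof. by move=> [] [] //= => /esym /C01. Qed.

Lemma concatenation_inj : injective concatenation.
Proof.
move=> s s' ss'; apply/funext => n; apply: letter_block_inj.
rewrite -!concat_block_even; apply: eq_from_tnth => t.
by rewrite -!concatenationE ss'.
Qed.

(** The system of concatenations at phase 0 is contained in the one at phase
    [d]. *)
Let phase (d : int) : Prop := forall z, no_BBb z ->
  exists2 z', no_BBb z' & concatenation z = shiftz d (concatenation z').

Let phaseD d d' : phase d -> phase d' -> phase (d + d').
Proof.
move=> pd pd' z /pd[z1 /pd'[z2 z2O ->] ->].
by exists z2; rewrite // shiftzD.
Qed.

Let phase_period a : phase ((2 ^ k.+1)%N%:Z * a).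
Proof.
move=> z zO; exists (shiftz (- a) z); first exact: no_BBb_shiftz.
by rewrite concatenation_shiftz shiftzD mulrN addrN shiftz0.
Qed.

Let phaseM d (j : nat) : phase d -> phase (d * j%:Z).
Proof.
move=> pd; elim: j => [|j IHj].
  by have := phase_period 0; rewrite !mulr0.
by rewrite (_ : d * j.+1%:Z = d * j%:Z + d); [exact: phaseD | lia].
Qed.

(** One coincidence propagates to all overlap-free sequences by minimality. *)
Let phase_start d z z' : no_BBb z -> no_BBb z' ->
  concatenation z = shiftz d (concatenation z') -> phase d.
Proof.
move=> zO z'O zz'.
(* The closed invariant property is to be coded into [S]. *)
pose S : set (fullshift A) := (@shiftz A d \o concatenation) @` no_BBb.
have cS : closed S.
  apply: compact_closed; first exact: fullshift_hausdorff.
  apply: continuous_compact; last exact: closed_fullshift_compact no_BBb_closed.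
  apply: continuous_subspaceT => s; apply: continuous_comp.
    exact: concatenation_continuous.
  exact: shiftz_continuous.
suff: no_BBb `<=` concatenation @^-1` S.
  by move=> sub w /sub[w' w'O ww']; exists w'.
apply: (no_BBb_minimal _ _ _ zO).
- by move/continuous_closedP: concatenation_continuous; apply.
- move=> n w [w' w'O ww']; exists (shiftz n w'); first exact: no_BBb_shiftz.
  by rewrite /= !concatenation_shiftz -ww' /= !shiftzD addrC.
by exists z'.
Qed.

(** Otherwise the Morse sequence [m] has a companion [z] such that each is
    read off the other by the gap rule, up to an offset. Both unprimed and
    primed blocks are then among C0 and C1, which leaves four gap rules. If
    both primed blocks agree, then 0110 or 1001 in [m] forces 000 or 111 in
    [z]; if they differ, the rule copies the complement of one neighbor and
    contradicts the first letters of [m]. *)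
Let half_phaseF : ~ phase (2 ^ k)%N%:Z.
Proof.
move=> /(_ _ morse_no_BBb)[z zO mz].
have blockE m : concat_block morse_sequence m = concat_block z (m + 1).
  apply: eq_from_tnth => t; rewrite -!concatenationE mz /shiftz.
  by congr concatenation; lia.
set m := morse_sequence in mz blockE.
have E1 n : letter_block (m n) = gap_block C0 C1 C0' C1' (z n) (z (n + 1)).
  by rewrite -concat_block_even blockE concat_block_odd.
have E2 n : gap_block C0 C1 C0' C1' (m n) (m (n + 1)) = letter_block (z (n + 1)).
  rewrite -concat_block_odd blockE -concat_block_even.
  by congr concat_block; lia.
have [m0 m1 m2 m3 [m4 m5 m6 m7]] := morse_prefix; rewrite -/m in m0 m1 m2 m3 m4 m5 m6 m7.
have [b C1b] : exists b, C1' = letter_block b.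
  by exists (z 1); have := E2 0; rewrite add0r m0 m1.
have [a C0a] : exists a, C0' = letter_block a.
  by exists (z 3); have := E2 2; rewrite m2 [m (_ + _)]m3.
pose g l r := match l, r with
  | true, true => false | false, false => true
  | true, false => a | false, true => b end.
have gE l r : gap_block C0 C1 C0' C1' l r = letter_block (g l r).
  by case: l r => [] []; rewrite /= ?C0a ?C1b.
have {}E1 n : m n = g (z n) (z (n + 1)) by apply: letter_block_inj; rewrite E1 gE.
have {}E2 n : z (n + 1) = g (m n) (m (n + 1)).
  by apply: letter_block_inj; rewrite -E2 gE.
have z1 : z 1 = g false true by rewrite (E2 0) m0 [m (_ + _)]m1.
have z2 : z 2 = g true true by rewrite (E2 1) m1 [m (_ + _)]m2.
have z3 : z 3 = g true false by rewrite (E2 2) m2 [m (_ + _)]m3.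
have z5 : z 5 = g true false by rewrite (E2 4) m4 [m (_ + _)]m5.
have z6 : z 6 = g false false by rewrite (E2 5) m5 [m (_ + _)]m6.
have z7 : z 7 = g false true by rewrite (E2 6) m6 [m (_ + _)]m7.
have n123 := no_cube zO 0 1%N; have n567 := no_cube zO 0 5%N.
rewrite !add0r in n123 n567.
rewrite z1 z2 z3 in n123; rewrite z5 z6 z7 in n567.
have := E1 1; have := E1 0; rewrite m0 m1 add0r [z (_ + _)]z2 z1 /=.
move: n123 n567 (z 0); rewrite /g.
by move: (a) (b) => [] [] //= _ _ [].
Qed.

Lemma concatenation_phase e z z' : no_BBb z -> no_BBb z' ->
  concatenation z = shiftz e (concatenation z') ->
  ((2 ^ k.+1)%N%:Z %| e)%Z.
Proof.
move=> zO z'O /(phase_start zO z'O) pe; apply: contrapT => /negP.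
move=> /power2_multiple[j [a eE]]; apply: half_phaseF.
by rewrite -eE; apply: phaseD; [exact: phaseM | exact: phase_period].
Qed.

End Recognizability.
End Concatenation.

(** * Concatenation systems with blocks of equal length are conjugate *)

Section Transfer.
Variables (A B : finType) (k : nat).
Variables C0 C1 C0' C1' : (2 ^ k)%N.-tuple A.
Variables E0 E1 E0' E1' : (2 ^ k)%N.-tuple B.

Let F := concatenation C0 C1 C0' C1'.
Let G := concatenation E0 E1 E0' E1'.

(** The coded sequence and the phase of [x] are kept, the C's are replaced by the
    E's; points that are not concatenations go to an arbitrary value. *)
Definition transfer (x : fullshift A) : fullshift B :=
  xget (G morse_sequence)
    [set y | exists e s, [/\ no_BBb s, x = shiftz e (F s) & y = shiftz e (G s)]].

Hypothesis C01 : C0 <> C1.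

Lemma transferE e s : no_BBb s -> transfer (shiftz e (F s)) = shiftz e (G s).
Proof.
move=> sO; apply: xget_unique; first by exists e, s.
move=> y [e' [s' [s'O FF' ->]]].
have Fs : F s = shiftz (e' - e) (F s').
  by rewrite addrC -shiftzD -FF' shiftzD addNr shiftz0.
have /dvdzP[a eE] := concatenation_phase C01 sO s'O Fs.
have -> : s = shiftz a s'.
  apply: (@concatenation_inj _ _ _ _ C0' C1' C01); rewrite -/F Fs eE mulrC.
  by rewrite /F concatenation_shiftz.
by rewrite /G concatenation_shiftz shiftzD mulrC -eE addrC subrK.
Qed.

Lemma transfer_continuous :
  {within [set x | morse_concatenation C0 C1 C0' C1' x], continuous transfer}.
Proof.
apply: (@compact_lift_continuous 'I_(2 ^ k.+1) _ _ _ no_BBb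
  (phase_code C0 C1 C0' C1') (phase_code E0 E1 E0' E1')).
- exact: fullshift_hausdorff.
- exact: closed_fullshift_compact no_BBb_closed.
- exact: phase_code_continuous.
- exact: phase_code_continuous.
- exact: morse_concatenationE.
- by move=> e s sO; exact: transferE.
Qed.

End Transfer.

Lemma concatenations_conjugate (A B : finType) (k : nat)
    (C0 C1 C0' C1' : (2 ^ k)%N.-tuple A) (E0 E1 E0' E1' : (2 ^ k)%N.-tuple B) :
  C0 <> C1 -> E0 <> E1 ->
  topologically_conjugate
    [set x | morse_concatenation C0 C1 C0' C1' x] (@shift A)
    [set y | morse_concatenation E0 E1 E0' E1' y] (@shift B).
Proof.
move=> C01 E01.
pose h := transfer C0 C1 C0' C1' E0 E1 E0' E1'.
pose g := transfer E0 E1 E0' E1' C0 C1 C0' C1'.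
have hE := transferE C0' C1' E0 E1 E0' E1' C01.
have gE := transferE E0' E1' C0 C1 C0' C1' E01.
have hK : {in [set x | morse_concatenation C0 C1 C0' C1' x], cancel h g}.
  move=> x /set_mem /morse_concatenationP[e [s [sO ->]]].
  by rewrite /h /g hE // gE.
exists h, g; split=> //.
- split.
  + move=> x /morse_concatenationP[e [s [sO ->]]]; apply/morse_concatenationP.
    by exists e, s; rewrite /h hE.
  + exact: can_in_inj hK.
  + move=> y /morse_concatenationP[e [s [sO ->]]].
    exists (shiftz e (concatenation C0 C1 C0' C1' s)); last exact: hE.
    by apply/morse_concatenationP; exists e, s.
- exact: transfer_continuous.
- exact: transfer_continuous.
- move=> x /set_mem /morse_concatenationP[e [s [sO ->]]].
  by rewrite /shift shiftzD /h !hE // shiftzD.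
Qed.

(** * The Morse minimal set as a concatenation system *)

(** The word mu^k(c). *)
Definition morse_block (k : nat) (c : bool) : (2 ^ k)%N.-tuple bool :=
  [tuple c (+) iter k mubar (fun=> false) t%:Z | t < (2 ^ k)%N].

Lemma morse_block_neq k : morse_block k false <> morse_block k true.
Proof.
have lt0 : (0 < 2 ^ k)%N by rewrite expn_gt0.
move=> /(congr1 (fun w => tnth w (Ordinal lt0))).
by rewrite !tnth_mktuple; case: (iter _ _ _ _).
Qed.

Lemma iter_mubar_concatenation k (z : fullshift bool) :
  iter k.+1 mubar z = concatenation (morse_block k false) (morse_block k true)
    (morse_block k false) (morse_block k true) z.
Proof.
rewrite -[RHS]shiftz0; apply/eq_concatenation => m t.
have lt_t := ltn_ord t.
rewrite iterSr subr0 iter_mubar_block; last lia.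
have [n [->|->]] := even_or_odd m.
- rewrite concat_block_even mubar_even /letter_block.
  by case: (z n); rewrite tnth_mktuple.
rewrite concat_block_odd mubar_odd.
by case: (z n) (z (n + 1)) => [] []; rewrite /= tnth_mktuple.
Qed.

Lemma morse_minimal_set_concatenation k :
  morse_minimal_set = [set y | morse_concatenation
    (morse_block k false) (morse_block k true)
    (morse_block k false) (morse_block k true) y].
Proof.
rewrite morse_minimal_setE; apply/seteqP; split=> y.
  move=> /(desubstitution_iter k.+1)[e [s [sO ->]]].
  by apply/morse_concatenationP; exists e, s; rewrite iter_mubar_concatenation.
move=> /morse_concatenationP[e [s [sO ->]]]; rewrite -iter_mubar_concatenation.
exact/no_BBb_shiftz/iter_mubar_no_BBb.
Qed.

(** * Minimal sets containing a concatenation *)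

Lemma shift_invariant (A : finType) (X : set (fullshift A)) n x :
  @shift A @` X = X -> X x -> X (shiftz n x).
Proof.
move=> SX; have Sp m y : X y -> X (shiftz m%:Z y).
  elim: m y => [|m IHm] y Xy; first by rewrite shiftz0.
  rewrite (_ : m.+1%:Z = m%:Z + 1); last lia.
  by rewrite -shiftzD; apply: IHm; rewrite -SX; exists y.
have Sn m y : X y -> X (shiftz (- m%:Z) y).
  elim: m y => [|m IHm] y Xy; first by rewrite oppr0 shiftz0.
  move: Xy; rewrite -{1}SX => -[z Xz <-].
  rewrite /shift shiftzD (_ : - m.+1%:Z + 1 = - m%:Z); last lia.
  exact: IHm.
move=> Xx; have [nE|nE] : n = `|n|%N%:Z \/ n = - `|n|%N%:Z by lia.
  by rewrite nE; exact: Sp.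
by rewrite nE; exact: Sn.
Qed.

Section MinimalSets.
Variables (A : finType) (X : set (fullshift A)).
Hypothesis minX : symbolic_minimal X.

Let X_shiftz n x : X x -> X (shiftz n x).
Proof. by case: minX => _ _ SX _; exact: shift_invariant. Qed.

Let X_closed : closed X. Proof. by case: minX. Qed.

Section Parametrized.
Variables (k : nat) (C0 C1 C0' C1' : (2 ^ k)%N.-tuple A).
Hypothesis XC : exists x, X x /\ morse_concatenation C0 C1 C0' C1' x.

(** Concatenations form a closed invariant set, which therefore contains the
    orbit closure of each of its points. *)
Lemma all_concatenations x : X x -> morse_concatenation C0 C1 C0' C1' x.
Proof.
have [x0 [Xx0 x0C]] := XC; have [_ _ _ /(_ x0 Xx0) dense] := minX.
move=> /dense clx; apply: (@morse_concatenation_closed A k C0 C1 C0' C1').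
apply: closure_subset clx; apply: orbit_sub => //.
exact: morse_concatenation_shiftz.
Qed.

Lemma minimal_set_concatenations :
  X = [set x | morse_concatenation C0 C1 C0' C1' x].
Proof.
apply/seteqP; split=> [|x]; first exact: all_concatenations.
move=> /morse_concatenationP[e [s [sO ->]]]; apply: X_shiftz.
have [x0 [Xx0 /morse_concatenationP[e0 [s0 [s0O x0E]]]]] := XC.
apply: (@no_BBb_minimal (concatenation C0 C1 C0' C1' @^-1` X) s0) => //.
- have /continuous_closedP := @concatenation_continuous A k C0 C1 C0' C1'.
  by apply.
- by move=> n y Xy; rewrite /preimage /= concatenation_shiftz; exact: X_shiftz.
by rewrite /preimage /= -[concatenation _ _ _ _ _]shiftz0 -(addNr e0) -shiftzD -x0E;
  exact: X_shiftz.
Qed.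

End Parametrized.

(** * A conjugacy with the Morse minimal set produces blocks *)

Section Conjugate.
Variables (h : fullshift A -> fullshift bool) (g : fullshift bool -> fullshift A).
Hypotheses (hXM : set_bij X morse_minimal_set h)
  (hK : {in X, cancel h g})
  (h_cont : {within X, continuous h})
  (g_cont : {within morse_minimal_set, continuous g})
  (h_shift : {in X, forall x, h (shift x) = shift (h x)}).

Let gM y : no_BBb y -> X (g y) /\ h (g y) = y.
Proof.
rewrite -morse_minimal_setE => My; have [_ _ surj] := hXM.
by have [x Xx <-] := surj y My; rewrite hK ?inE.
Qed.

Let h_shiftz n x : X x -> h (shiftz n x) = shiftz n (h x).
Proof.
have hp m y : X y -> h (shiftz m%:Z y) = shiftz m%:Z (h y).
  move=> Xy; elim: m => [|m IHm]; first by rewrite !shiftz0.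
  rewrite (_ : m.+1%:Z = 1 + m%:Z); last lia.
  rewrite -[RHS]shiftzD -IHm -shiftzD.
  by apply: h_shift; rewrite inE; exact: X_shiftz.
move=> Xx; have [nE|nE] : n = `|n|%N%:Z \/ n = - `|n|%N%:Z by lia.
  by rewrite nE hp.
have -> : h x = shiftz (- n) (h (shiftz n x)).
  have nn : - n = `|n|%N%:Z by lia.
  rewrite nn -hp; last exact: X_shiftz.
  by rewrite shiftzD -nn addNr shiftz0.
by rewrite shiftzD addrN shiftz0.
Qed.

Let g_shiftz n y : no_BBb y -> g (shiftz n y) = shiftz n (g y).
Proof.
move=> yO; have [Xg hg] := gM yO.
by rewrite -{1}hg -h_shiftz // hK // inE; exact: X_shiftz.
Qed.

Let h_local : exists r : nat, forall x (i j : int), X x ->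
  (forall u : int, - r%:Z <= u <= r%:Z -> x (i + u) = x (j + u)) -> h x i = h x j.
Proof.
have [r hr] := uniform_local_rule X_closed h_cont.
exists r => x i j Xx xij.
have hE l : h x l = h (shiftz l x) 0 by rewrite h_shiftz // /shiftz add0r.
rewrite !hE; apply: hr => [||u le_u]; [exact: X_shiftz | exact: X_shiftz |].
by rewrite /shiftz ![u + _]addrC xij.
Qed.

Let g_local : exists r : nat, forall y (i j : int), no_BBb y ->
  (forall u : int, - r%:Z <= u <= r%:Z -> y (i + u) = y (j + u)) -> g y i = g y j.
Proof.
have cM : closed morse_minimal_set by exact: closed_closure.
have [r gr] := uniform_local_rule cM g_cont.
exists r => y i j yO yij.
have gE l : g y l = g (shiftz l y) 0 by rewrite g_shiftz // /shiftz add0r.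
rewrite !gE; apply: gr => [||u le_u].
- by rewrite morse_minimal_setE; exact: no_BBb_shiftz.
- by rewrite morse_minimal_setE; exact: no_BBb_shiftz.
by rewrite /shiftz ![u + _]addrC yij.
Qed.

(** The letters of [m] at 0, 2, 5, 1 begin the words 01, 10, 00, 11, so these
    positions give the blocks C0, C1, C0' and C1'. If C0 and C1 were equal,
    then [h], being local, would give [y] equal letters inside mu^k(0) and
    mu^k(1), which are complementary. *)
Lemma conjugate_concatenation : exists (k : nat) (C0 C1 C0' C1' : (2 ^ k)%N.-tuple A),
  C0 <> C1 /\ exists x, X x /\ morse_concatenation C0 C1 C0' C1' x.
Proof.
have [r hr] := h_local; have [q gq] := g_local.
(* Blocks longer than both windows: 2q < N makes displaced blocks depend on two
   letters, and 2r < N leaves a letter of [y] determined by a single block. *)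
pose k := (2 * q + 2 * r)%N; set N := (2 ^ k)%N.
have ltN : (2 * q + 2 * r < N)%N by exact: ltn_expl.
set m := morse_sequence; pose y := iter k mubar m.
have yO : no_BBb y by apply: iter_mubar_no_BBb; exact: morse_no_BBb.
have [Xx hx] := gM yO; set x := g y in Xx hx.
have [m0 m1 m2 m3 [m4 m5 m6 m7]] := morse_prefix; rewrite -/m in m0 m1 m2 m3 m4 m5 m6 m7.
pose W (p : int) : (2 ^ k)%N.-tuple A := [tuple of word x (q%:Z + N%:Z * p) N].
have WE p (t : 'I_(2 ^ k)) : tnth (W p) t = x (q%:Z + N%:Z * p + t%:Z).
  by rewrite (tnth_nth (x 0)) nth_mkseq.
have Weq p p' : m p = m p' -> m (p + 1) = m (p' + 1) -> W p = W p'.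
  move=> mp mp1; apply: eq_from_tnth => t; rewrite !WE; apply: gq => // u le_u.
  have e l : q%:Z + N%:Z * l + t%:Z + u = N%:Z * l + (q%:Z + t%:Z + u).
    by rewrite [q%:Z + _]addrC !addrA.
  rewrite !e; apply: iter_mubar_window => //.
  have := ltn_ord t; rewrite -/N; clear -le_u ltN; lia.
exists k, (W 0), (W 2), (W 5), (W 1); split.
  have lt_qr : 0 <= q%:Z + r%:Z < (2 ^ k)%N%:Z by rewrite -/N; clear -ltN; lia.
  move=> W02; suff : y (N%:Z * 0 + (q%:Z + r%:Z)) = y (N%:Z * 2 + (q%:Z + r%:Z)).
    by rewrite /y !iter_mubar_block // m0 m2; case: (iter _ _ _ _).
  rewrite -hx; apply: hr => // u le_u.
  have lt_t : (`|(r%:Z + u)%R| < 2 ^ k)%N by rewrite -/N; clear -le_u ltN; lia.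
  have := congr1 (fun w => tnth w (Ordinal lt_t)) W02; rewrite !WE /=.
  have -> : `|(r%:Z + u)%R|%N%:Z = r%:Z + u by clear -le_u; lia.
  by rewrite ![q%:Z + N%:Z * _]addrC !addrA.
exists x; split=> //; exists q%:Z, (mubar m : fullshift bool).
have mE n : m (2 * n) = mubar m n /\ m (2 * n + 1) = ~~ mubar m n.
  have [mm _ _] := morse_sequenceP; rewrite -/m in mm.
  by rewrite -mm mubar_even mubar_odd mm.
split=> [n||n]; first 1 last.
- by apply: mubar_no_BBb; exact: morse_no_BBb.
- rewrite -/N -[LHS]/(val (W (2 * n + 1))) /gap_block.
  have [_ e1] := mE n; have [e2 _] := mE (n + 1).
  have e3 : m (2 * n + 1 + 1) = mubar m (n + 1).
    by rewrite -e2 mulrDr mulr1 -addrA.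
  case: (mubar m n) e1 => e1; case: (mubar m (n + 1)) e3 => e3; congr val;
    by apply: Weq; rewrite ?e1 ?e3.
rewrite -/N -[LHS]/(val (W (2 * n))).
have [e1 e2] := mE n; case: (mubar m n) e1 e2 => e1 e2; congr val;
  by apply: Weq; rewrite ?e1 ?e2.
Qed.

End Conjugate.
End MinimalSets.

(** * The characterization *)

Theorem mainTheorem3 (A : finType) (X : set (fullshift A))
    (minX : symbolic_minimal X) :
  (topologically_conjugate X (@shift A) morse_minimal_set (@shift bool) <->
   exists (k : nat) (C0 C1 C0' C1' : (2 ^ k)%N.-tuple A),
     C0 <> C1 /\ exists x, X x /\ morse_concatenation C0 C1 C0' C1' x) /\
  (forall (k : nat) (C0 C1 C0' C1' : (2 ^ k)%N.-tuple A),
     C0 <> C1 ->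
     (exists x, X x /\ morse_concatenation C0 C1 C0' C1' x) ->
     forall x, X x -> morse_concatenation C0 C1 C0' C1' x).
Proof.
split; last by move=> k C0 C1 C0' C1' _; exact: all_concatenations.
split=> [[h [g [hXM hK hc gc hS]]]|[k [C0 [C1 [C0' [C1' [C01 XC]]]]]]].
  exact: (conjugate_concatenation minX hXM hK hc gc hS).
rewrite (minimal_set_concatenations minX XC) (morse_minimal_set_concatenation k).
by apply: concatenations_conjugate => //; exact: morse_block_neq.
Qed.
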